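(* Every arithmetic progression contains infinitely many Zeckendorf-Niven numbers. That is, for all positive integers $a,d$, the arithmetic progression $(a+kd)_{k=0}^\infty$ contains infinitely many Zeckendorf-Niven numbers.
   Context: Let $\mathbb{N}$ be the set of positive integers and let $F_i$ be the Fibonacci numbers: $F_0=0$, $F_1=1$, $F_i=F_{i-1}+F_{i-2}$ for $i\ge 2$. By Zeckendorf's theorem, every $n\in\mathbb{N}$ has a unique sequence $(\zeta_i(n))_{i=2}^\infty$ with $\zeta_i(n)\in\{0,1\}$ and $\zeta_i(n)+\zeta_{i+1}(n)\le 1$ for all $i\ge 2$, such that $n=\sum_{i=2}^\infty \zeta_i(n)F_i$ (the Zeckendorf decomposition of $n$). Put $s_Z(n)=\sum_{i=2}^\infty\zeta_i(n)$, the number of summands in the Zeckendorf decomposition. A positive integer $n$ is called Zeckendorf-Niven if $s_Z(n)$ divides $n$. An arithmetic progression is an infinite sequence of positive integers $(a+kd)_{k=0}^\infty$ with $a,d\in\mathbb{N}$. *)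

(* Defs.v *)
From mathcomp Require Import all_boot.
From mathcomp Require Import zify.

Set Implicit Arguments.
Unset Strict Implicit.
Unset Printing Implicit Defensive.

Fixpoint fib (n : nat) : nat :=
  match n with
  | 0 => 0
  | 1 => 1
  | (m.+1 as p).+1 => fib p + fib m
  end.

(* u_2 + u_3 + u_4 + ... = s. A series of natural numbers converges if and only
   if its partial sums are eventually constant. *)
Definition sum_from2 (u : nat -> nat) (s : nat) : Prop :=
  exists N, forall M, N <= M -> \sum_(2 <= i < M) u i = s.

(* The values z 0 and z 1 are irrelevant: indices start at 2. *)
Definition is_zeckendorf (n : nat) (z : nat -> bool) : Prop :=
  (forall i, 2 <= i -> z i + z i.+1 <= 1) /\
  sum_from2 (fun i => z i * fib i) n.

Lemma fibSS n : fib n.+2 = fib n.+1 + fib n.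
Proof. by []. Qed.

Lemma fib_gt0 n : 0 < fib n.+1.
Proof. by elim: n => [//|n IH]; rewrite fibSS addn_gt0 IH. Qed.

Lemma fib_gt n : n < fib n.+2.
Proof.
elim: n => [//|n IH]; have := fib_gt0 n; move: IH.
by rewrite (fibSS n.+1); move: (fib n.+2) (fib n.+1) => x y; lia.
Qed.

Lemma sum_stable (u : nat -> nat) N M : 2 <= N -> N <= M ->
  (forall i, N <= i -> u i = 0) ->
  \sum_(2 <= i < M) u i = \sum_(2 <= i < N) u i.
Proof.
move=> N2 NM u0; rewrite (big_cat_nat (n := N)) //=.
suff -> : \sum_(N <= i < M) u i = 0 by rewrite addn0.
by apply: big1_seq => i /andP[_]; rewrite mem_index_iota => /andP[/u0].
Qed.

Lemma zeckendorf_bounded k n : n < fib k.+1 ->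
  {z : nat -> bool | [/\ forall i, z i + z i.+1 <= 1,
     forall i, k < i -> z i = false &
     \sum_(2 <= i < k.+1) z i * fib i = n]}.
Proof.
elim/ltn_ind: k n => -[|[|k]] IH n nk.
- exists (fun=> false); split=> //; rewrite big_geq //.
  by move: nk => /=; lia.
- exists (fun=> false); split=> //; rewrite big_geq //.
  by move: nk => /=; lia.
case: (ltnP n (fib k.+2)) => nk2.
  have [z [z1 z0 zs]] := IH k.+1 (ltnSn _) n nk2.
  exists z; split=> // [i ki|]; first by apply: z0; lia.
  by rewrite big_nat_recr //= zs z0 // mul0n addn0.
have mk : n - fib k.+2 < fib k.+1 by move: nk; rewrite (fibSS k.+1); lia.
have [z [z1 z0 zs]] := IH k (ltnW (ltnSn _)) _ mk.
exists (fun i => (i == k.+2) || z i); split=> [i|i ki|].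
- case: (eqVneq i k.+2) => [->|ik] /=; first by rewrite z0 ?orbF; lia.
  case: (eqVneq i.+1 k.+2) => [[->]|_] /=; last exact: z1.
  by rewrite z0 ?orbF; lia.
- by rewrite z0 ?orbF; lia.
rewrite big_nat_recr //= eqxx mul1n.
suff -> : \sum_(2 <= i < k.+2) ((i == k.+2) || z i) * fib i = n - fib k.+2.
  by move: nk2 => /=; lia.
rewrite -zs (eq_big_nat _ _ (F2 := fun i => z i * fib i)); last first.
  by move=> i /andP[_ ik]; rewrite ltn_eqF.
case: k {IH nk nk2 mk zs z1} z0 => [|k] z0; first by rewrite !big_geq.
by rewrite big_nat_recr //= z0 // mul0n addn0.
Qed.

Lemma zeckendorf_exists n : {z : nat -> bool | is_zeckendorf n z}.
Proof.
have [z [z1 z0 zs]] := zeckendorf_bounded (fib_gt n).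
exists z; split=> [i _|]; first exact: z1.
exists n.+2 => M nM; rewrite -zs; apply: sum_stable => // i ni.
by rewrite z0.
Qed.

Lemma zeckendorf_sum_lt (z : nat -> bool) N :
  (forall i, 2 <= i -> z i + z i.+1 <= 1) ->
  \sum_(2 <= i < N.+1) z i * fib i < fib N.+1.
Proof.
move=> z1; elim/ltn_ind: N => -[|[|N]] IH; [by rewrite big_geq..|].
rewrite big_nat_recr //= -fibSS.
case zN: (z N.+2); last first.
  have := IH N.+1 (ltnSn _); rewrite mul0n addn0; move: (fib N.+1) => f.
  by rewrite fibSS; lia.
rewrite mul1n.
case: N => [|N] in IH zN *; first by rewrite big_geq.
have zN1 : z N.+2 = false by have := z1 N.+2 isT; rewrite zN; case: (z N.+2).
have {IH} := IH N.+1 (ltnW (ltnSn _)).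
rewrite (big_nat_recr N.+2) //= zN1 mul0n addn0 -!fibSS.
by rewrite (fibSS N.+2) addnC ltn_add2l.
Qed.

Lemma zeckendorf_unique n (z w : nat -> bool) :
  is_zeckendorf n z -> is_zeckendorf n w -> forall i, 2 <= i -> z i = w i.
Proof.
move=> [z1 [N zs]] [w1 [M ws]] i i2.
set K := maxn i.+1 (maxn N M).
have : \sum_(2 <= j < K) z j * fib j = \sum_(2 <= j < K) w j * fib j.
  by rewrite zs ?ws //; lia.
have : i < K by lia.
elim: {zs ws}K => [//|K IH].
rewrite ltnS leq_eqVlt => /orP iK.
have K2 : 2 <= K by case: iK => [/eqP|]; lia.
rewrite !big_nat_recr //=.
have := zeckendorf_sum_lt K.-1 z1; have := zeckendorf_sum_lt K.-1 w1.
rewrite prednK; last by lia.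
case: iK => [/eqP <-|/IH {}IH]; first by case: (z i); case: (w i) => //=; lia.
by case: (z K); case: (w K) => //= ? ? ?; try lia; apply: IH; lia.
Qed.

Definition zeta (n : nat) : nat -> bool := sval (zeckendorf_exists n).

Lemma zetaP n : is_zeckendorf n (zeta n).
Proof. exact: svalP (zeckendorf_exists n). Qed.

Lemma zeta_eq n z : is_zeckendorf n z -> forall i, 2 <= i -> zeta n i = z i.
Proof. exact: zeckendorf_unique (zetaP n). Qed.

(* The infinite sum stops at i = n + 1 because fib i > n for i >= n + 2; see
   s_ZP. *)
Definition s_Z (n : nat) : nat := \sum_(2 <= i < n.+2) zeta n i.

Lemma zeta_large n i : n.+2 <= i -> zeta n i = false.
Proof.
move=> ni; have [_ [N zs]] := zetaP n; apply/negP => zi.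
have : fib i <= n.
  rewrite -(zs (maxn N i.+1)); last by lia.
  rewrite (big_cat_nat (n := i.+1)) //=; [|lia|lia].
  by rewrite big_nat_recr /=; [rewrite zi mul1n; lia|lia].
have : i.-2 < fib i by have := fib_gt i.-2; rewrite (_ : i.-2.+2 = i) //; lia.
lia.
Qed.

Lemma s_ZP n : sum_from2 (zeta n) (s_Z n).
Proof.
exists n.+2 => M nM; apply: sum_stable => // i ni.
by rewrite zeta_large.
Qed.

Definition zeckendorf_niven (n : nat) : Prop := 0 < n /\ s_Z n %| n.

(* Main.v *)
Require Import Defs.
From mathcomp Require Import all_boot.
From mathcomp Require Import classical_sets cardinality.
From mathcomp Require Import ssralg zmodp zify.

(** Choose [q > 0] with [F_(j q + 1) = 1] modulo [a d] for every [j], by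
    pure periodicity of the Fibonacci sequence. A sum [n] of [a] such Fibonacci
    numbers with pairwise non-adjacent indices satisfies [s_Z(n) = a] and
    [n = a] modulo [a d], so [a] divides [n] and [n = a] modulo [d]. *)

Local Open Scope classical_set_scope.

(** The step [(x, y) -> (y, x + y)] on pairs of residues is injective on a finite set, so the orbit
    of [(0, 1)] is a cycle with no preperiod. *)
Lemma fib_period m : 0 < m ->
  exists2 p, 0 < p & forall j, fib (j * p).+1 = 1 %[mod m].
Proof.
case: m => // m _.
pose f (x : 'I_m.+1 * 'I_m.+1) := (x.2, (x.1 + x.2)%R).
have f_inj : injective f.
  apply: (can_inj (g := fun y => ((y.2 - y.1)%R, y.1))) => -[x y].
  by rewrite /f /= GRing.addrK.
pose x0 : 'I_m.+1 * 'I_m.+1 := (inZp 0, inZp 1).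
have iterE n : iter n f x0 = (inZp (fib n), inZp (fib n.+1)).
  elim: n => [//|n IH]; rewrite iterS IH /f /=; congr pair.
  by apply: val_inj; rewrite /= modnDm addnC.
exists (order f x0) => [|j]; first exact: order_gt0.
have iterj : iter (j * order f x0) f x0 = x0.
  by elim: j => [//|j IH]; rewrite mulSn iterD IH iter_order.
by have := iterE (j * order f x0); rewrite iterj => -[_ <-].
Qed.

Lemma fib_eq1_mod m N : 0 < m ->
  exists2 k, N < k & fib k = 1 %[mod m].
Proof.
move=> /fib_period[p p0 pP]; exists (N * p).+1; last exact: pP.
by rewrite ltnS leq_pmulr.
Qed.

(** Induction on [s]: each step adds one Fibonacci number congruent to 1, with index beyond all
    those used. The empty sum is 0, hence the guard [0 < s]. *)
Lemma zeckendorf_sum_eq_mod m s N : 0 < m ->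
  exists z : nat -> bool, exists M,
  [/\ forall i, z i + z i.+1 <= 1,
      forall i, M.+2 <= i -> z i = false,
      \sum_(2 <= i < M.+2) z i = s,
      \sum_(2 <= i < M.+2) z i * fib i = s %[mod m] &
      0 < s -> N <= \sum_(2 <= i < M.+2) z i * fib i].
Proof.
move=> m0; elim: s => [|s [z [M [z1 z0 zs zf _]]]].
  by exists (fun=> false), 0; split; rewrite // big_geq.
(* Passing [M.+2] keeps [k] non-adjacent to the old indices; passing it by more than [N] forces
   [fib k] above [N]. *)
have [k kMN fk] := fib_eq1_mod m (N + M.+2) m0.
pose w i := (i == k) || z i.
(* The weight [g] is 1 for the digit count and [fib] for the value. *)
have sum_w g : \sum_(2 <= i < k.+1) w i * g i =
    \sum_(2 <= i < M.+2) z i * g i + g k.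
  rewrite big_nat_recr /=; last by lia.
  rewrite {2}/w eqxx mul1n; congr (_ + _).
  rewrite (eq_big_nat _ _ (F2 := fun i => z i * g i)); last first.
    by move=> i /andP[_ ik]; rewrite /w ltn_eqF.
  by apply: sum_stable => [||i Mi]; [|lia|rewrite z0].
exists w, k.-1; have -> : k.-1.+2 = k.+1 by lia.
split=> [i|i ki||| _].
- have := z1 i; rewrite /w.
  case: (eqVneq i k) => [->|_] /=; first by rewrite !z0; lia.
  by case: (eqVneq i.+1 k) => [ik|//]; rewrite !z0; lia.
- by rewrite /w z0; lia.
- under eq_bigr do rewrite -[nat_of_bool _]muln1.
  by rewrite sum_w; under eq_bigr do rewrite muln1; rewrite zs addn1.
- by rewrite sum_w -modnDm zf fk modnDm addn1.
- have := fib_gt k.-2; have -> : k.-2.+2 = k by lia.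
  by rewrite sum_w; lia.
Qed.

(** By uniqueness of the digits, [s_Z] can be read off any explicit decomposition; the two series
    are compared at a common cutoff. *)
Lemma s_Z_eq n z s : is_zeckendorf n z -> sum_from2 z s -> s_Z n = s.
Proof.
move=> nz [N zs]; have [K sK] := s_ZP n.
rewrite -(sK (maxn N K)) ?leq_maxr // -(zs (maxn N K)) ?leq_maxl //.
by apply: eq_big_nat => i /andP[i2 _]; rewrite (zeta_eq nz).
Qed.

Lemma infinite_nat_unbounded (A : set nat) :
  (forall N, exists2 n, N <= n & A n) -> infinite_set A.
Proof.
move=> Aub /finite_seqP[s As].
have [n sn] := Aub (\max_(i <- s) i).+1; rewrite As /= => ns.
by have := @leq_bigmax_seq _ s xpredT id n ns isT; lia.
Qed.

Theorem theorem2p6 (a d : nat) (ha : 0 < a) (hd : 0 < d) :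
  infinite_set (range (fun k : nat => a + k * d) `&`
                [set n : nat | zeckendorf_niven n]).
Proof.
apply: infinite_nat_unbounded => N.
have ad0 : 0 < a * d by rewrite muln_gt0 ha.
(* In the bound [N + a], the [N] gives unboundedness and the [a] keeps [n - a] from truncating. *)
have [z [M [z1 z0 zs zf]]] := zeckendorf_sum_eq_mod _ a (N + a) ad0.
move=> /(_ ha); set n := \sum_(_ <= _ < _) _ in zf * => Nn.
have an : a <= n by lia.
have /dvdnP[k nk] : a * d %| n - a by rewrite -eqn_mod_dvd // zf.
have nE : n = a + k * (a * d) by rewrite -nk subnKC.
exists n; first by lia.
split; first by exists (k * a) => //; rewrite nE mulnA.
split; first by lia.
have nz : is_zeckendorf n z.
  by split=> [i _|]; [|exists M.+2 => K MK; apply: sum_stable => // i /z0 ->].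
have sz : sum_from2 z a.
  by exists M.+2 => K MK; rewrite -zs; apply: sum_stable => // i /z0 ->.
by rewrite (s_Z_eq _ _ _ nz sz) nE dvdn_addr // dvdn_mull // dvdn_mulr.
Qed.
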